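(* Let $R$ be the pullback ring of ring epimorphisms $R_1\xrightarrow{v_1}\overline R\xleftarrow{v_2}R_2$. Every $R$-linear map $f\colon S\to T$ between separated $R$-modules is separated.
   Context: Rings are unital and modules are (left) modules. $v_1,v_2$ are surjective ring homomorphisms, $R=\{(r_1,r_2)\in R_1\oplus R_2: v_1(r_1)=v_2(r_2)\}$, and $P_i=\ker v_i$. Any $\overline R$-module is an $R_i$-module via $v_i$. Given $R_i$-modules $S_i$ ($i=1,2$), an $\overline R$-module $\overline S$ and $R_i$-linear maps $p_i\colon S_i\to\overline S$, the pullback $S=\{(s_1,s_2): p_1(s_1)=p_2(s_2)\}$ is an $R$-module by $(r_1,r_2)(s_1,s_2)=(r_1s_1,r_2s_2)$; it is called a pullback module with pullback diagram $S_1\xrightarrow{p_1}\overline S\xleftarrow{p_2}S_2$. The diagram is separated if each $p_i$ is surjective and $\ker p_i=P_iS_i$; an $R$-module is separated if it is (isomorphic to) the pullback of a separated diagram. A subdirect sum presentation $S\subset S_1\oplus S_2$ of an $R$-module $S$ is an identification of $S$ with an $R$-submodule of $S_1\oplus S_2$, where $S_i$ is an $R_i$-module, such that both projections $S\to S_1$ and $S\to S_2$ are surjective. A homomorphism $f\colon S\to T$ between separated $R$-modules is called separated if it is induced by $R_i$-linear maps $f_i\colon S_i\to T_i$ ($i=1,2$), i.e. $f(s_1,s_2)=(f_1(s_1),f_2(s_2))$, for some subdirect sum presentations $S\subset S_1\oplus S_2$ and $T\subset T_1\oplus T_2$. *)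

(* Defs.v *)
From HB Require Import structures.
From mathcomp Require Import all_boot all_algebra.

Set Implicit Arguments.
Unset Strict Implicit.
Unset Printing Implicit Defensive.

Import GRing.Theory.
Local Open Scope ring_scope.

(* Rings are pzRingType: unital, not necessarily commutative, and the zero
   ring is allowed. *)

Definition surjective (A B : Type) (f : A -> B) : Prop :=
  forall y, exists x, f x = y.

Section PullbackRing.
Variables (R1 R2 Rbar : pzRingType).
Variables (v1 : {rmorphism R1 -> Rbar}) (v2 : {rmorphism R2 -> Rbar}).

Definition in_pullback_ring : {pred R1 * R2} :=
  fun r => v1 r.1 == v2 r.2.

Fact in_pullback_ring_subring : subring_closed in_pullback_ring.
Proof.
split; rewrite ?unfold_in /= ?rmorph1 //.
- by move=> x y; rewrite !unfold_in /= !rmorphB => /eqP-> /eqP->.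
- by move=> x y; rewrite !unfold_in /= !rmorphM => /eqP-> /eqP->.
Qed.

HB.instance Definition _ :=
  GRing.isSubringClosed.Build (R1 * R2)%type in_pullback_ring
    in_pullback_ring_subring.

Record pullback_ring : Type := PullbackRing {
  pbr_val : R1 * R2;
  _ : pbr_val \in in_pullback_ring }.

HB.instance Definition _ := [isSub for pbr_val].
HB.instance Definition _ := [Choice of pullback_ring by <:].
HB.instance Definition _ :=
  GRing.SubChoice_isSubPzRing.Build _ _ pullback_ring in_pullback_ring_subring.

End PullbackRing.

(* The group S1 * S2 does not determine R, so v1 and v2 are kept as phantom
   arguments from which the R-module structure is inferred. *)
Definition dirsum (R1 R2 Rbar : pzRingType)
    (v1 : {rmorphism R1 -> Rbar}) (v2 : {rmorphism R2 -> Rbar})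
    (S1 : lmodType R1) (S2 : lmodType R2) : Type := (S1 * S2)%type.

Section Modules.
Variables (R1 R2 Rbar : pzRingType).
Variables (v1 : {rmorphism R1 -> Rbar}) (v2 : {rmorphism R2 -> Rbar}).

Local Notation R := (pullback_ring v1 v2).

Section DirectSum.
Variables (S1 : lmodType R1) (S2 : lmodType R2).
Local Notation D := (dirsum v1 v2 S1 S2).

HB.instance Definition _ := GRing.Zmodule.copy D (S1 * S2)%type.

Definition dirsum_scale (r : R) (s : D) : D :=
  ((pbr_val r).1 *: s.1, (pbr_val r).2 *: s.2).

Fact dirsum_scaleA a b s :
  dirsum_scale a (dirsum_scale b s) = dirsum_scale (a * b) s.
Proof. by rewrite /dirsum_scale /= !scalerA. Qed.

Fact dirsum_scale1 : left_id 1 dirsum_scale.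
Proof. by case=> x y; rewrite /dirsum_scale /= !scale1r. Qed.

Fact dirsum_scaleDr : right_distributive dirsum_scale +%R.
Proof. by move=> a x y; rewrite /dirsum_scale /= !scalerDr. Qed.

Fact dirsum_scaleDl s : {morph dirsum_scale^~ s : a b / a + b}.
Proof. by move=> a b; rewrite /dirsum_scale /= !scalerDl. Qed.

HB.instance Definition _ := GRing.Zmodule_isLmodule.Build R D
  dirsum_scaleA dirsum_scale1 dirsum_scaleDr dirsum_scaleDl.

End DirectSum.

Section PullbackModule.
Variables (S1 : lmodType R1) (S2 : lmodType R2) (Sbar : lmodType Rbar).
(* R_i-linearity into Sbar, an R_i-module by restriction of scalars along v_i:
   p_i (r *: s) = v_i r *: p_i s. *)
Variables (p1 : {linear S1 -> Sbar | v1 \; *:%R}).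
Variables (p2 : {linear S2 -> Sbar | v2 \; *:%R}).

Definition in_pullback_module : {pred dirsum v1 v2 S1 S2} :=
  fun s => p1 s.1 == p2 s.2.

Fact in_pullback_module_submod : submod_closed in_pullback_module.
Proof.
split=> [|r x y]; rewrite !unfold_in /= ?raddf0 //.
move=> /eqP ex /eqP ey; rewrite !linearD !linearZ /= ex ey.
by case: r => r /= /eqP ->.
Qed.

HB.instance Definition _ :=
  GRing.isSubmodClosed.Build R (dirsum v1 v2 S1 S2) in_pullback_module
    in_pullback_module_submod.

Record pullback_module : Type := PullbackModule {
  pbm_val : dirsum v1 v2 S1 S2;
  _ : pbm_val \in in_pullback_module }.

HB.instance Definition _ := [isSub for pbm_val].
HB.instance Definition _ := [Choice of pullback_module by <:].
HB.instance Definition _ := [SubChoice_isSubLmodule of pullback_module by <:].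

End PullbackModule.

End Modules.

(* x lies in P M, where P = ker v; P M is the set of finite sums of products. *)
Definition in_ker_smul (A B : pzRingType) (v : {rmorphism A -> B})
    (M : lmodType A) (x : M) : Prop :=
  exists (n : nat) (r : 'I_n -> A) (m : 'I_n -> M),
    (forall i, v (r i) = 0) /\ x = \sum_(i < n) r i *: m i.

Section Separated.
Variables (R1 R2 Rbar : pzRingType).
Variables (v1 : {rmorphism R1 -> Rbar}) (v2 : {rmorphism R2 -> Rbar}).

Local Notation R := (pullback_ring v1 v2).

Definition separated_diagram (S1 : lmodType R1) (S2 : lmodType R2)
    (Sbar : lmodType Rbar) (p1 : {linear S1 -> Sbar | v1 \; *:%R})
    (p2 : {linear S2 -> Sbar | v2 \; *:%R}) : Prop :=
  [/\ surjective p1, surjective p2,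
      forall x, p1 x = 0 <-> in_ker_smul v1 x
    & forall x, p2 x = 0 <-> in_ker_smul v2 x].

Definition separated_module (S : lmodType R) : Prop :=
  exists (S1 : lmodType R1) (S2 : lmodType R2) (Sbar : lmodType Rbar)
         (p1 : {linear S1 -> Sbar | v1 \; *:%R})
         (p2 : {linear S2 -> Sbar | v2 \; *:%R})
         (phi : {linear S -> pullback_module p1 p2}),
    separated_diagram p1 p2 /\ bijective phi.

(* The identification of S with a submodule of S1 (+) S2 is an injective
   R-linear map. *)
Definition subdirect_presentation (S : lmodType R) (S1 : lmodType R1)
    (S2 : lmodType R2) (iota : {linear S -> dirsum v1 v2 S1 S2}) : Prop :=
  [/\ injective iota,
      surjective (fun s => (iota s).1) & surjective (fun s => (iota s).2)].

Definition separated_hom (S T : lmodType R) (f : {linear S -> T}) : Prop :=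
  exists (S1 : lmodType R1) (S2 : lmodType R2)
         (T1 : lmodType R1) (T2 : lmodType R2)
         (iS : {linear S -> dirsum v1 v2 S1 S2})
         (iT : {linear T -> dirsum v1 v2 T1 T2})
         (f1 : {linear S1 -> T1}) (f2 : {linear S2 -> T2}),
    [/\ subdirect_presentation iS, subdirect_presentation iT
      & forall s, iT (f s) = (f1 (iS s).1, f2 (iS s).2)].

End Separated.

(* Main.v *)
Require Import Defs.
From HB Require Import structures.
From mathcomp Require Import all_boot all_algebra.

(** The presentation of a separated module [S] is forced by its [R]-module
    structure.  Let [rho1 : R -> R1] and [rho2 : R -> R2] be the two coordinate
    maps of the pullback ring.  If [S] is the pullback of a separated diagram
    [S1 -> Sbar <- S2], then the kernel of the projection [S -> S1] is
    [(ker rho1) S] ([separated_subdirect]): an element [(0, x)] of [S] has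
    [p2 x = 0], so [x] is a sum of products [r m] with [v2 r = 0]; each [m] is
    the second coordinate of some [t] in [S] because [p1] is onto, each
    [(0, r)] lies in [R], and [(0, x)] is the sum of the [(0, r) t].  Thus [S1]
    is the quotient of [S] by [(ker rho1) S], and likewise for [S2].

    For an [R]-linear [f : S -> T], the composite [S -> T -> T1] is
    [rho1]-semilinear, so it kills [(ker rho1) S] ([semilinear_ker_smul]) and
    factors through [S -> S1] ([descend_linear]).  The factor is additive, and
    it is [R1]-linear because [rho1] is onto, which is where surjectivity of
    [v2] enters; the other side uses [v1].  The two factors induce [f]. *)

Set Implicit Arguments.
Unset Strict Implicit.
Unset Printing Implicit Defensive.

Import GRing.Theory.
Local Open Scope ring_scope.

Section KernelMultiples.
Variables (A B : pzRingType) (rho : {rmorphism A -> B}).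

Lemma semilinear_ker_smul (S : lmodType A) (N : lmodType B)
    (g : {linear S -> N | rho \; *:%R}) s :
  in_ker_smul rho s -> g s = 0.
Proof.
case=> n [r [m [r0 ->]]]; rewrite linear_sum big1 // => i _.
by rewrite linearZ /= r0 scale0r.
Qed.

(** A surjection with kernel [(ker rho) S] is the universal [rho]-semilinear
    map out of [S].  Surjectivity of [rho] makes the induced map [B]-linear:
    a scalar of [B] can be lifted to [A] and moved across [p] and [g]. *)
Lemma descend_linear (S : lmodType A) (M N : lmodType B)
    (p : {linear S -> M | rho \; *:%R}) (g : {linear S -> N | rho \; *:%R}) :
  surjective rho -> surjective p -> (forall s, p s = 0 -> in_ker_smul rho s) ->
  exists h : {linear M -> N}, forall s, h (p s) = g s.
Proof.
move=> rho_surj p_surj ker_p.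
have lift x : exists s, p s == x by have [s <-] := p_surj x; exists s.
pose h x := g (xchoose (lift x)).
have hp s : h (p s) = g s.
  apply/eqP; rewrite -subr_eq0 -linearB; apply/eqP/semilinear_ker_smul/ker_p.
  by rewrite linearB (eqP (xchooseP (lift (p s)))) subrr.
have h_linear : linear h.
  move=> b x y; have [a <-] := rho_surj b.
  have [s <-] := p_surj x; have [t <-] := p_surj y.
  have -> : rho a *: p s + p t = p (a *: s + t) by rewrite linearD linearZ.
  by rewrite !hp linearD linearZ.
pose hL := GRing.isLinear.Build B M N *:%R h h_linear.
by exists (HB.pack_for {linear M -> N} h hL).
Qed.

(** Used with [A] the pullback ring, [rho] one coordinate and [sigma] the
    other: a multiple [x] of [ker v] in one summand is then the coordinate of
    some [s] in [(ker sigma) S], and every [sigma]-semilinear map, such as the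
    other coordinate, vanishes at [s]. *)
Lemma lift_ker_smul (B' C : pzRingType) (sigma : {rmorphism A -> B'})
    (v : {rmorphism B -> C}) (S : lmodType A) (M : lmodType B)
    (q : {linear S -> M | rho \; *:%R}) x :
  (forall b, v b = 0 -> exists a, rho a = b /\ sigma a = 0) ->
  surjective q -> in_ker_smul v x ->
  exists s, in_ker_smul sigma s /\ q s = x.
Proof.
move=> ker_lift q_surj [n [b [m [b0 ->]]]].
have [a aP] := fin_all_exists (fun i => ker_lift (b i) (b0 i)).
have [t tP] := fin_all_exists (fun i => q_surj (m i)).
exists (\sum_(i < n) a i *: t i); split.
  by exists n, a, t; split=> // i; case: (aP i).
rewrite linear_sum; apply: eq_bigr => i _.
by rewrite linearZ /= tP (aP i).1.
Qed.

End KernelMultiples.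

Section Coordinates.
Variables (R1 R2 Rbar : pzRingType).
Variables (v1 : {rmorphism R1 -> Rbar}) (v2 : {rmorphism R2 -> Rbar}).
Local Notation R := (pullback_ring v1 v2).

Definition ring_coord1 (r : R) : R1 := (pbr_val r).1.
Definition ring_coord2 (r : R) : R2 := (pbr_val r).2.

HB.instance Definition _ := GRing.isZmodMorphism.Build R R1 ring_coord1
  (fun _ _ => erefl).
HB.instance Definition _ := GRing.isMonoidMorphism.Build R R1 ring_coord1
  (erefl, fun _ _ => erefl).
HB.instance Definition _ := GRing.isZmodMorphism.Build R R2 ring_coord2
  (fun _ _ => erefl).
HB.instance Definition _ := GRing.isMonoidMorphism.Build R R2 ring_coord2
  (erefl, fun _ _ => erefl).

Lemma pullback_ring_pair r1 r2 : v1 r1 = v2 r2 ->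
  exists r : R, ring_coord1 r = r1 /\ ring_coord2 r = r2.
Proof. by move/eqP=> e; exists (@PullbackRing _ _ _ v1 v2 (r1, r2) e). Qed.

Lemma ring_coord1_surj : surjective v2 -> surjective ring_coord1.
Proof.
move=> v2_surj r1; have [r2 e] := v2_surj (v1 r1).
by have [r [<- _]] := pullback_ring_pair (esym e); exists r.
Qed.

Lemma ring_coord2_surj : surjective v1 -> surjective ring_coord2.
Proof.
move=> v1_surj r2; have [r1 e] := v1_surj (v2 r2).
by have [r [_ <-]] := pullback_ring_pair e; exists r.
Qed.

Section ModuleCoordinates.
Variables (S1 : lmodType R1) (S2 : lmodType R2).
Local Notation D := (dirsum v1 v2 S1 S2).

Definition coord1 (s : D) : S1 := s.1.
Definition coord2 (s : D) : S2 := s.2.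

HB.instance Definition _ :=
  GRing.isLinear.Build R D S1 (ring_coord1 \; *:%R) coord1
    (fun _ _ _ => erefl).
HB.instance Definition _ :=
  GRing.isLinear.Build R D S2 (ring_coord2 \; *:%R) coord2
    (fun _ _ _ => erefl).

End ModuleCoordinates.

(** The kernel of each projection is read off from the [R]-module [S] alone.
    The presentation is the pullback itself: an element with one coordinate
    zero has the other in [ker p_j = P_j S_j], and [lift_ker_smul] lifts it to
    an element with the same two coordinates. *)
Lemma separated_subdirect (S : lmodType R) : separated_module S ->
  exists (S1 : lmodType R1) (S2 : lmodType R2)
         (i : {linear S -> dirsum v1 v2 S1 S2}),
    [/\ subdirect_presentation i,
        forall s, coord1 (i s) = 0 -> in_ker_smul ring_coord1 s
      & forall s, coord2 (i s) = 0 -> in_ker_smul ring_coord2 s].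
Proof.
case=> S1 [S2 [Sbar [p1 [p2 [phi [[p1_surj p2_surj ker_p1 ker_p2] phi_bij]]]]]].
pose i : {linear S -> dirsum v1 v2 S1 S2} := val \o phi.
have i_inj : injective i by apply: inj_comp; [apply: val_inj | apply: bij_inj].
have iP s : p1 (i s).1 = p2 (i s).2 by apply/eqP; apply: (valP (phi s)).
have i_onto x1 x2 : p1 x1 = p2 x2 -> exists s, i s = (x1, x2).
  move/eqP=> e; have [psi _ psiK] := phi_bij.
  exists (psi (@PullbackModule _ _ _ v1 v2 S1 S2 Sbar p1 p2 (x1, x2) e)).
  by rewrite /i /= psiK.
have i1_surj : surjective (@coord1 S1 S2 \o i).
  move=> x1; have [x2 e] := p2_surj (p1 x1).
  by have [s /(congr1 (@coord1 S1 S2)) es] := i_onto _ _ (esym e); exists s.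
have i2_surj : surjective (@coord2 S1 S2 \o i).
  move=> x2; have [x1 e] := p1_surj (p2 x2).
  by have [s /(congr1 (@coord2 S1 S2)) es] := i_onto _ _ e; exists s.
exists S1, S2, i; split=> // s s0.
- have /ker_p2 xP : p2 (i s).2 = 0 by rewrite -iP (s0 : (i s).1 = 0) linear0.
  have [|t [tP et]] := lift_ker_smul (rho := ring_coord2)
    (sigma := ring_coord1) (q := @coord2 S1 S2 \o i) _ i2_surj xP.
    move=> b b0; have [|r []] := @pullback_ring_pair 0 b; last by exists r.
    by rewrite rmorph0.
  suff -> : s = t by [].
  apply: i_inj; rewrite [LHS]surjective_pairing [RHS]surjective_pairing.
  congr (_, _); last exact: esym et.
  have /= t0 := semilinear_ker_smul (@coord1 S1 S2 \o i) tP.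
  exact: etrans s0 (esym t0).
- have /ker_p1 xP : p1 (i s).1 = 0 by rewrite iP (s0 : (i s).2 = 0) linear0.
  have [|t [tP et]] := lift_ker_smul (rho := ring_coord1)
    (sigma := ring_coord2) (q := @coord1 S1 S2 \o i) _ i1_surj xP.
    move=> b b0; have [|r []] := @pullback_ring_pair b 0; last by exists r.
    by rewrite rmorph0.
  suff -> : s = t by [].
  apply: i_inj; rewrite [LHS]surjective_pairing [RHS]surjective_pairing.
  congr (_, _); first exact: esym et.
  have /= t0 := semilinear_ker_smul (@coord2 S1 S2 \o i) tP.
  exact: etrans s0 (esym t0).
Qed.

End Coordinates.

Theorem proposition3p6 (R1 R2 Rbar : pzRingType)
  (v1 : {rmorphism R1 -> Rbar}) (v2 : {rmorphism R2 -> Rbar})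
  (v1_surj : surjective v1) (v2_surj : surjective v2)
  (S T : lmodType (pullback_ring v1 v2))
  (S_sep : separated_module S) (T_sep : separated_module T)
  (f : {linear S -> T}) :
  separated_hom f.
Proof.
have [S1 [S2 [iS [iS_sub ker1 ker2]]]] := separated_subdirect S_sep.
have [T1 [T2 [iT [iT_sub _ _]]]] := separated_subdirect T_sep.
have [_ iS1_surj iS2_surj] := iS_sub.
have [f1 f1P] := descend_linear
  (p := @coord1 _ _ _ v1 v2 S1 S2 \o iS)
  (@coord1 _ _ _ v1 v2 T1 T2 \o (iT \o f))
  (ring_coord1_surj v1 v2_surj) iS1_surj ker1.
have [f2 f2P] := descend_linear
  (p := @coord2 _ _ _ v1 v2 S1 S2 \o iS)
  (@coord2 _ _ _ v1 v2 T1 T2 \o (iT \o f))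
  (ring_coord2_surj v2 v1_surj) iS2_surj ker2.
exists S1, S2, T1, T2, iS, iT, f1, f2; split=> // s.
rewrite [LHS]surjective_pairing.
by congr (_, _); [exact: esym (f1P s) | exact: esym (f2P s)].
Qed.
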